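(* Let $G$ be a finite group of order $n$. Then the following are equivalent: (1) $G$ has a regular row transversal; (2) (the multiplication table of) $G$ can be partitioned into $n$ mutually disjoint regular row transversals; (3) Sylow $2$-subgroups of $G$ are trivial or non-cyclic; (4) $1\in P(G)$.
   Context: The multiplication table of $G$ is the set of triples $\{(x,y,xy):x,y\in G\}$; in a triple $(x,y,z)$, $x$ is the row, $y$ the column and $z$ the entry. A regular row transversal of $G$ is a subset $T$ of the multiplication table such that each element of $G$ appears as the row of precisely one triple in $T$, and every $s\in G$ appears as a column of triples in $T$ the same number of times as it appears as an entry of triples in $T$. $P(G)$ is the set of elements of $G$ that can be written as a product $g_1\cdots g_n$ in which every element of $G$ occurs precisely once, over all orderings. *)

(* Defs.v *)
From mathcomp Require Import all_boot all_fingroup all_solvable.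

Set Implicit Arguments.
Unset Strict Implicit.
Unset Printing Implicit Defensive.

Import GroupScope.

Section Definitions.

Variables (gT : finGroupType) (G : {group gT}).

Definition mul_table : {set gT * gT * gT} :=
  [set (x, y, x * y) | x in G, y in G].

Definition row (t : gT * gT * gT) : gT := t.1.1.
Definition column (t : gT * gT * gT) : gT := t.1.2.
Definition entry (t : gT * gT * gT) : gT := t.2.

Definition regular_row_transversal (T : {set gT * gT * gT}) : Prop :=
  [/\ T \subset mul_table,
      forall x, x \in G -> #|[set t in T | row t == x]| = 1%N
    & forall s, s \in G ->
        #|[set t in T | column t == s]| = #|[set t in T | entry t == s]|].

(* A sequence s lists every element of G precisely once iff it is a
   permutation of the duplicate-free sequence [enum G]. *)
Definition full_products : {set gT} :=
  [set \prod_(g <- s) g | s : #|G|.-tuple gT & perm_eq s (enum G)].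

End Definitions.

(* Main.v *)
(** A row transversal whose columns and entries agree as multisets forces every
    homomorphism [f] from [G] to an abelian group to satisfy [\sum_(x in G) f x = 0].
    If a Sylow 2-subgroup [S] is cyclic and nontrivial, with involution [z], the
    transfer [G -> S] sends every involution of [G] to [z ^+ #|G : S| = z]; since
    non-involutions cancel against their inverses and [G] has an odd number of
    involutions, the sum is [z], a contradiction.

    Conversely, to order [G] with product 1, elements which are not involutions
    are paired with their inverses.  For an involution [g], the involutions
    moved by [g] come in conjugate pairs and can be arranged around [g] so as to
    give a block with product [g].  If [G] contains a Klein four-group
    [V = {1, a, b, ab}], apply this to [a], then to [b]; the involutions
    centralised by [V] split into cosets of [V], each with product 1, and the
    remaining factor is [a * b * (a * b) = 1].  Otherwise [S] is generalised
    quaternion, distinct involutions never commute, all of them form a block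
    with product [z], and [z] is also a commutator [[~ i, j]] of elements of
    order 4, so the four elements [i^-1], [j^-1], [i], [j] cancel [z].

    If [g_1 ... g_n = 1], then placing [g_(i+1) ... g_n] in row [g_i] gives the
    entry [g_i ... g_n], which is the column of the previous row. *)

Require Import Defs.
From mathcomp Require Import all_boot all_fingroup all_solvable ssralg.

Set Implicit Arguments.
Unset Strict Implicit.
Unset Printing Implicit Defensive.

Import GroupScope.

(** * Halving a set by an involution, and ordered products over subsets *)

(** Every orbit of [f] on [A] has two elements; keeping the one of smaller enumeration rank gives
    [s], and [f] maps it onto the rest. *)
Lemma fixedfree_involution_half (T : finType) (A : {set T}) (f : T -> T) :
    {in A, forall x, f x \in A} -> {in A, forall x, f (f x) = x} ->
    {in A, forall x, f x != x} ->
  exists s : seq T, perm_eq (s ++ map f s) (enum A).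
Proof.
move=> fA ffK fne; pose U := [set x in A | enum_rank x < enum_rank (f x)].
have sUA x : x \in U -> x \in A by rewrite inE => /andP[].
have fU x : x \in A -> (f x \in U) = (x \notin U).
  move=> Ax; rewrite !inE fA // ffK // Ax /= -leqNgt [RHS]leq_eqVlt.
  suff /negPf->: (enum_rank (f x) : nat) != enum_rank x by [].
  by rewrite (inj_eq (@ord_inj _)) (inj_eq enum_rank_inj) fne.
exists (enum U); apply: uniq_perm; rewrite ?enum_uniq //.
  rewrite cat_uniq enum_uniq map_inj_in_uniq ?enum_uniq => [|x y]; last first.
    rewrite !mem_enum => /sUA Ax /sUA Ay eq_f.
    by rewrite -[x]ffK // eq_f ffK.
  rewrite andbT; apply/hasPn=> _ /mapP[x Ux ->]; move: Ux; rewrite /= !mem_enum.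
  by move=> Ux; rewrite fU ?Ux ?sUA.
move=> x; rewrite mem_cat !mem_enum; apply/orP/idP=> [[/sUA//|]|Ax].
  by case/mapP=> y; rewrite mem_enum => /sUA Ay ->; apply: fA.
have [Ux | U'x] := boolP (x \in U); [by left | right].
by apply/mapP; exists (f x); rewrite ?ffK // mem_enum fU.
Qed.

(** Membership in [full_products], generalised to subsets so that an ordering of a group can be
    assembled from blocks. *)
Definition arranges_to (gT : finGroupType) (A : {set gT}) (g : gT) : Prop :=
  exists2 s : seq gT, perm_eq s (enum A) & \prod_(x <- s) x = g.

Section Arrangements.

Variable gT : finGroupType.
Implicit Types (A B C : {set gT}) (a b g h x y z : gT).

Lemma invg_sqr x : x * x = 1 -> x^-1 = x.
Proof. by move=> xx; apply/eqP; rewrite eq_invg_mul xx. Qed.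

Lemma arranges_to_set0 : arranges_to set0 (1 : gT).
Proof. by exists [::]; rewrite ?enum_set0 ?big_nil. Qed.

Lemma arranges_to_set1 x : arranges_to [set x] x.
Proof. by exists [:: x]; rewrite ?enum_set1 ?big_seq1. Qed.

Lemma arranges_to_seq (s : seq gT) :
  uniq s -> arranges_to [set x in s] (\prod_(x <- s) x).
Proof.
move=> Us; exists s => //; apply: uniq_perm; rewrite ?enum_uniq // => x.
by rewrite mem_enum inE.
Qed.

Lemma arranges_toU A B g h :
  [disjoint A & B] -> arranges_to A g -> arranges_to B h ->
  arranges_to (A :|: B) (g * h).
Proof.
move=> dAB [s sA <-] [t tB <-]; exists (s ++ t); last by rewrite big_cat.
apply: uniq_perm; rewrite ?enum_uniq //; last first.
  by move=> x; rewrite mem_cat (perm_mem sA) (perm_mem tB) !mem_enum inE.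
rewrite cat_uniq (perm_uniq sA) (perm_uniq tB) !enum_uniq andbT /=.
apply/hasPn=> x; rewrite /= (perm_mem sA) (perm_mem tB) !mem_enum => Bx.
by rewrite (disjointFl dAB Bx).
Qed.

Lemma arranges_to_split A (P : pred gT) g h :
    arranges_to [set x in A | P x] g -> arranges_to [set x in A | ~~ P x] h ->
  arranges_to A (g * h).
Proof.
move=> Ag Ah; have <-: [set x in A | P x] :|: [set x in A | ~~ P x] = A.
  by apply/setP=> x; rewrite !inE -andb_orr orbN andbT.
apply: arranges_toU => //; rewrite disjoint_subset; apply/subsetP=> x.
by rewrite !inE => /andP[-> ->].
Qed.

Lemma prodgV_rev (s : seq gT) : (\prod_(x <- s) x)^-1 = \prod_(x <- rev s) x^-1.
Proof.
elim: s => [|x s IHs]; first by rewrite !big_nil invg1.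
by rewrite rev_cons -cats1 big_cat big_seq1 big_cons invMg IHs.
Qed.

Lemma prodgJ (s : seq gT) g : (\prod_(x <- s) x) ^ g = \prod_(x <- s) x ^ g.
Proof. by elim: s => [|x s IHs]; rewrite ?big_nil ?conj1g // !big_cons conjMg IHs. Qed.

(** One half of [A] is followed by its inverses in reverse order, so the product telescopes. *)
Lemma arranges_to_invol_free A :
    {in A, forall x, x^-1 \in A} -> {in A, forall x, x^-1 != x} ->
  arranges_to A 1.
Proof.
move=> VA Vne.
have [s sA] := fixedfree_involution_half VA (in1W invgK) Vne.
exists (s ++ rev (map invg s)).
  by apply: perm_trans sA; rewrite perm_cat2l perm_rev.
by rewrite big_cat -map_rev big_map -prodgV_rev /= mulgV.
Qed.

(* With p the product of one half of A, the other half, conjugate under g and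
   taken in reverse order, has product (p^-1) ^ g, and p * g * (p^-1) ^ g = g. *)
Lemma arranges_to_moved A g :
    g * g = 1 -> {in A, forall x, x * x = 1} ->
    {in A, forall x, x ^ g \in A} -> {in A, forall x, x ^ g != x} ->
  arranges_to (g |: A) g.
Proof.
move=> gg AA Ag Ane.
have gK: {in A, forall x, (x ^ g) ^ g = x} by move=> x _; rewrite -conjgM gg conjg1.
have [s sA] := fixedfree_involution_half Ag gK Ane.
have A'g: g \notin A by apply/negP=> /Ane; rewrite conjgE mulKg eqxx.
have sub_s x : x \in s -> x \in A.
  by move=> sx; rewrite -mem_enum -(perm_mem sA) mem_cat sx.
exists (s ++ g :: rev (map (conjg^~ g) s)).
  apply: (@perm_trans _ (g :: enum A)).
    by rewrite perm_catC cat_cons perm_cons perm_catC -(permPr sA) perm_cat2l perm_rev.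
  apply: uniq_perm; rewrite ?enum_uniq //= ?mem_enum ?A'g ?enum_uniq // => x.
  by rewrite inE !mem_enum !inE.
rewrite big_cat big_cons -map_rev big_map -prodgJ /=.
(* The elements of [s] are their own inverses, so reversing their order inverts the product. *)
have ->: \prod_(x <- rev s) x = (\prod_(x <- s) x)^-1.
  rewrite prodgV_rev big_seq [RHS]big_seq; apply: eq_bigr => x.
  by rewrite mem_rev => /sub_s/AA/invg_sqr.
by rewrite conjgE !mulgA mulgK mulgV mul1g.
Qed.

(** Induction on the size of [A], removing one coset of the four-group at a time. Within a coset,
    [x], [a] and [b] commute, square to 1, and each occurs an even number of times in the product.
    Elements of different cosets need not commute. *)
Lemma arranges_to_four_cosets A a b :
    a * a = 1 -> b * b = 1 -> a != 1 -> b != 1 -> a != b -> commute a b ->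
    {in A, forall x, [/\ x * x = 1, commute x a, commute x b, a * x \in A
                       & b * x \in A]} ->
  arranges_to A 1.
Proof.
move=> aa bb a1 b1 neq_ab cab; have [m] := ubnP #|A|.
elim: m A => // m IHm A /ltnSE-leAm closedA.
have [-> | [x Ax]] := set_0Vmem A.
  exact: arranges_to_set0.
have [xx cxa cxb Aax Abx] := closedA x Ax.
have [_ _ _ _ Abax] := closedA _ Aax.
pose s := [:: x; a * x; b * x; b * (a * x)].
have [aK bK] : involutive (mulg a) /\ involutive (mulg b).
  by split=> y; rewrite mulgA ?aa ?bb mul1g.
have Us: uniq s.
  have aba: a * (b * a) = b by rewrite -cab aK.
have neq_ba: b * a != 1.
    by rewrite -eq_invg_mul invg_sqr // eq_sym.
  (* Right translation by [x] reduces distinctness to the four-group itself. *)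
  have -> : s = map (mulg^~ x) [:: 1; a; b; b * a] by rewrite /= -mulgA mul1g.
  rewrite (map_inj_uniq (mulIg x)) /= !inE !negb_or !(eq_sym 1) a1 b1 neq_ab neq_ba /=.
  rewrite -{1}(mul1g a) (inj_eq (mulIg a)) -{2}(mulg1 b) (inj_eq (mulgI b)).
  by rewrite !(eq_sym 1) a1 b1.
have sA: [set y in s] \subset A.
  apply/subsetP=> y; rewrite !inE.
  by case/or4P=> /eqP->.
(* Stability of the coset makes its complement in [A] closed again, as the induction requires. *)
have stable_s: {in s, forall y, a * y \in s /\ b * y \in s}.
  move=> y; rewrite !inE => /or4P[]/eqP->; split; rewrite ?aK ?bK ?eqxx ?orbT //.
    by rewrite mulgA cab -mulgA eqxx !orbT.
  by rewrite mulgA cab -mulgA aK eqxx !orbT.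
have prods: \prod_(y <- s) y = 1.
  rewrite !big_cons big_nil mulg1 !mulgA cxa -(mulgA a) xx mulg1.
  rewrite -(mulgA (a * b)) cxb mulgA -(mulgA a b b) bb mulg1 -(mulgA a) cxa.
  by rewrite mulgA aa mul1g.
rewrite -[1]mulg1; apply: (@arranges_to_split _ [in s]).
  have ->: [set y in A | y \in s] = [set y in s].
    apply/setP=> y; rewrite [LHS]inE [RHS]inE; apply: andb_idl => sy.
    by apply: (subsetP sA); rewrite inE.
  by rewrite -prods; apply: arranges_to_seq.
apply: IHm.
  apply: leq_trans leAm; apply/proper_card/properP; split.
    by apply/subsetP=> y; rewrite inE => /andP[].
  by exists x => //; rewrite !inE eqxx andbF.
move=> y /setIdP[Ay s'y]; have [yy cya cyb Aay Aby] := closedA y Ay.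
split=> //; rewrite inE ?Aay ?Aby; apply: contra s'y => /stable_s[].
  by rewrite aK.
by rewrite bK.
Qed.

(** * Orderings of a whole group with product 1 *)

(** [A] holds elements set aside to contribute a chosen product; all other elements of square
    different from 1 cancel against their inverses. [A] is nonempty only in the quaternion case. *)
Lemma arranges_to_invol_split (G : {group gT}) A g h :
    A \subset G -> {in A, forall x, (x * x != 1) && (x^-1 \in A)} ->
    arranges_to A g -> arranges_to [set x in G | x * x == 1] h ->
  arranges_to G (h * g).
Proof.
move=> sAG A2 Ag Dh; apply: (arranges_to_split Dh); rewrite -[g]mulg1.
apply: (@arranges_to_split _ [in A]).
  congr (arranges_to _ g): Ag; apply/setP=> x; rewrite !inE.
  by case Ax: (x \in A); rewrite ?andbF // (subsetP sAG) //; case/andP: (A2 x Ax) => ->.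
apply: arranges_to_invol_free => x; rewrite !inE => /andP[/andP[Gx x2] A'x].
  rewrite groupV Gx -eq_invg_mul invgK eq_sym eq_invg_mul x2.
  by apply: contra A'x => /A2/andP[_]; rewrite invgK.
by rewrite eq_invg_mul.
Qed.

Lemma arranges_to_fours (G : {group gT}) a b :
    a \in G -> b \in G -> a * a = 1 -> b * b = 1 -> a != 1 -> b != 1 ->
    a != b -> commute a b ->
  arranges_to G 1.
Proof.
move=> Ga Gb aa bb a1 b1 neq_ab cab.
have [aK bK] : involutive (mulg a) /\ involutive (mulg b).
  by split=> x; rewrite mulgA ?aa ?bb mul1g.
have conj_fix x y : (x ^ y == x) = (y * x == x * y).
  by rewrite conjgE -(inj_eq (mulgI y)) mulKVg eq_sym.
(* From left to right: the block around [a], the block around [b], the leftover 1 and [b * a], the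
   other cosets of the four-group, and the elements whose square is not 1. *)
have ->: 1 = a * (b * (b * a * 1)) * 1 :> gT by rewrite !mulg1 bK aa.
apply: (arranges_to_invol_split (sub0set G) _ arranges_to_set0).
  by move=> x; rewrite inE.
apply: (@arranges_to_split _ (fun x => (x == a) || (x ^ a != x))).
  set A := [set x in _ | _].
  have ->: A = a |: [set x in G | (x * x == 1) && (x ^ a != x)].
    apply/setP=> x; rewrite !inE; have [->|_] /= := eqVneq x a; last by rewrite andbA.
    by rewrite Ga aa eqxx.
  apply: arranges_to_moved => // x /setIdP[Gx /andP[/eqP xx xa]] //.
  by rewrite !inE groupJ //= -conjMg xx conj1g eqxx (inj_eq (conjg_inj a)).
apply: (@arranges_to_split _ (fun x => (x == b) || (x ^ b != x))).
  set A := [set x in _ | _].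
  have ->: A = b |: [set x in G | [&& x * x == 1, x ^ a == x & x ^ b != x]].
    apply/setP=> x; rewrite !inE negb_or negbK; have [->|_] /= := eqVneq x b.
      by rewrite Gb bb eqxx eq_sym neq_ab conj_fix cab eqxx.
    have [->|_] /= := eqVneq x a; last by rewrite !andbA.
    by rewrite conj_fix cab eqxx !andbF.
  apply: arranges_to_moved => // x /setIdP[Gx /and3P[/eqP xx xa xb]] //.
  rewrite !inE groupJ //= -conjMg xx conj1g eqxx (inj_eq (conjg_inj b)) xb andbT.
  (* As [a] and [b] commute, conjugation by [b] keeps [x] in the centraliser of [a]. *)
  by rewrite -conjgM -cab conjgM (eqP xa) eqxx.
have aba: a * (b * a) = b by rewrite -cab aK.
have neq_ba: b * a != 1 by rewrite -eq_invg_mul invg_sqr // eq_sym.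
set A := [set x in _ | _].
have memA x : x \in A =
    [&& x \in G, x * x == 1, a * x == x * a, b * x == x * b, x != a & x != b].
  by rewrite !inE !negb_or !negbK !conj_fix -!andbA; do !bool_congr.
(* [a] and [b] were spent as centres of their blocks, so 1 and [b * a] are what remains of the
   four-group. *)
pose s := [:: 1; b * a]; apply: (@arranges_to_split _ [in s]).
  have <-: \prod_(x <- s) x = b * a by rewrite !big_cons big_nil mul1g mulg1.
  have ->: [set x in A | x \in s] = [set x in s].
    apply/setP=> x; rewrite inE memA [RHS]inE; apply: andb_idl.
    rewrite !inE => /pred2P[]->.
      by rewrite group1 !mulg1 !mul1g !eqxx !(eq_sym 1) a1 b1.
    rewrite groupM // -{2}cab mulgA -(mulgA b) aa mulg1 bb eqxx aba -mulgA cab !eqxx.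
    by rewrite -{2}(mul1g a) -{3}(mulg1 b)
               (inj_eq (mulIg a)) (inj_eq (mulgI b)) a1 b1.
  by apply: arranges_to_seq; rewrite /= inE eq_sym neq_ba.
apply: (arranges_to_four_cosets aa bb) => // x.
rewrite inE memA inE negb_or inE => /andP[/and5P[Gx /eqP xx /eqP cxa /eqP cxb]].
move=> /andP[xa xb] /andP[x1 xba].
have ax0 y : (a * x == y) = (x == a * y) by rewrite (inv_eq aK).
have bx0 y : (b * x == y) = (x == b * y) by rewrite (inv_eq bK).
split; rewrite /commute //; rewrite inE memA !inE !(ax0, bx0) negb_or.
  rewrite groupM // {1}cxa -!mulgA aK aa mulg1 -cab aK xx xa xb x1 -cxa -cxb.
  by rewrite aK (mulgA b) -cab -mulgA cab xba !eqxx.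
rewrite groupM // {1}cxb -!mulgA !bK bb mulg1 xx xa xb x1 xba -cxa -cxb.
by rewrite bK mulgA cab -mulgA !eqxx.
Qed.

Lemma arranges_to_odd (G : {group gT}) :
  {in G, forall x, x * x = 1 -> x = 1} -> arranges_to G 1.
Proof.
move=> G2; rewrite -[1]mulg1.
apply: (arranges_to_invol_split (sub0set G)) => [x||]; first by rewrite inE.
  exact: arranges_to_set0.
have ->: [set x in G | x * x == 1] = [set 1].
  apply/setP=> x; rewrite !inE; apply/andP/eqP=> [[Gx /eqP/G2->] // | ->].
  by rewrite group1 mulg1.
exact: arranges_to_set1.
Qed.

(** Since [z] moves every other involution, a single block around [z] uses up all involutions and
    has product [z]; the commutator supplies a second [z] to cancel it. *)
Lemma arranges_to_commutator (G : {group gT}) z i j :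
    z \in G -> i \in G -> j \in G -> z * z = 1 -> z != 1 ->
    {in G, forall x, x * x = 1 -> commute x z -> x \in [:: 1; z]} ->
    [~ i, j] = z -> i * i != 1 -> j * j != 1 -> j \notin [:: i; i^-1] ->
  arranges_to G 1.
Proof.
move=> Gz Gi Gj zz z1 Iz ij_z i2 j2; rewrite !inE negb_or => /andP[neq_ji neq_jVi].
pose s := [:: i^-1; j^-1; i; j].
have Us: uniq s.
  rewrite /= !inE !negb_or (inj_eq invg_inj) !eq_invg_mul (eq_sym i).
  by rewrite neq_ji i2 j2 -eq_invg_mul eq_sym neq_jVi -{1}(invgK i) -eq_mulgV1 neq_jVi.
have prods: \prod_(x <- s) x = z.
  by rewrite !big_cons big_nil mulg1 -ij_z commgEl conjgE.
rewrite -zz -{2}prods.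
apply: arranges_to_invol_split (arranges_to_seq Us) _.
- by apply/subsetP=> x; rewrite !inE => /or4P[]/eqP->; rewrite ?groupV.
- move=> x; rewrite !inE => /or4P[]/eqP->;
  rewrite ?invgK ?eqxx ?orbT ?andbT // -invMg ?invg_eq1 //.
rewrite -[z]mulg1; apply: (@arranges_to_split _ (fun x => (x == z) || (x ^ z != x))).
  set A := [set x in _ | _].
  have ->: A = z |: [set x in G | (x * x == 1) && (x ^ z != x)].
    apply/setP=> x; rewrite !inE; have [->|_] /= := eqVneq x z; last by rewrite andbA.
    by rewrite Gz zz eqxx.
  apply: arranges_to_moved => // x /setIdP[Gx /andP[/eqP xx xa]] //.
  by rewrite !inE groupJ //= -conjMg xx conj1g eqxx (inj_eq (conjg_inj z)).
set A := [set x in _ | _].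
have ->: A = [set 1].
  apply/setP=> x; rewrite !inE negb_or negbK.
  apply/andP/eqP=> [[/andP[Gx /eqP xx]] | ->].
    case/andP=> xz /eqP/conjg_fixP/commgP/(Iz x Gx xx).
    by rewrite !inE (negPf xz) orbF => /eqP.
  by rewrite group1 mulg1 conj1g !eqxx (eq_sym 1) z1.
exact: arranges_to_set1.
Qed.

End Arrangements.

Lemma arranges_to_Sylow2 (gT : finGroupType) (G : {group gT}) :
    (forall S : {group gT}, 2.-Sylow(G) S -> S :=: 1 \/ ~~ cyclic S) ->
  arranges_to G 1.
Proof.
have [S sylS] := Sylow_exists 2 G; move/(_ S sylS) => [S1 | ncS].
  have oddG: coprime #|G| 2.
    have:= card_Hall sylS; rewrite S1 cards1 coprimen2 => /esym/eqP.
    by rewrite p_part_eq1 mem_primes cardG_gt0 /= dvdn2 negbK.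
  apply: arranges_to_odd => x Gx /= xx; rewrite -(expgK oddG Gx) /=.
  by rewrite (expgS x 1) xx expg1n.
have [/exists_inP[a Ga /exists_inP[b Gb]] | noV] :=
  boolP [exists a in G, exists b in G,
    [&& a * a == 1, b * b == 1, a != 1, b != 1, a != b & a * b == b * a]].
  case/and5P=> /eqP aa /eqP bb a1 b1 /andP[neq_ab /eqP cab].
  exact: arranges_to_fours Ga Gb _ _ _ _ _ cab.
have{noV} cent_invol z : z \in G -> z * z = 1 -> z != 1 ->
    {in G, forall x, x * x = 1 -> commute x z -> x \in [:: 1; z]}.
  move=> Gz zz z1 x Gx xx cxz; apply: contraR noV; rewrite !inE negb_or.
  case/andP=> x1 xz; apply/exists_inP; exists x => //; apply/exists_inP.
  by exists z; rewrite // xx zz x1 z1 xz cxz !eqxx.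
have [sSG pS _] := and3P sylS.
have ntS: S :!=: 1 by apply: contraNneq ncS => ->; apply: cyclic1.
have ntZ: 'Z(S) != 1 by rewrite (center_nil_eq1 (pgroup_nil pS)).
have [_ /Cauchy[]// z Zz oz _] := pgroup_pdiv (pgroupS (center_sub S) pS) ntZ.
have /centerP[Sz cSz] := Zz.
have Gz := subsetP sSG z Sz.
have z1: z != 1 by rewrite -order_gt1 oz.
have zz: z * z = 1 by rewrite -(expgS z 1) -oz expg_order.
(* Any involution of [S] commutes with the central [z], so it equals [z]. A non-cyclic 2-group with
   a unique involution is generalised quaternion. *)
have oOhm: #|'Ohm_1(S)| = 2.
  rewrite -oz orderE; congr #|pred_of_set (_ : {set gT})|; apply/eqP.
  rewrite (OhmE 1 pS) eqEsubset cycle_subG mem_gen ?inE ?Sz ?(expgS z 1) ?zz ?eqxx //.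
  rewrite gen_subG andbT; apply/subsetP=> x; rewrite !inE (expgS x 1).
  case/andP=> Sx /eqP xx.
  have:= cent_invol z Gz zz z1 x (subsetP sSG x Sx) xx (commute_sym (cSz x Sx)).
  by rewrite !inE => /pred2P[]->; rewrite ?group1 ?cycle_id.
have:= introT (prime_Ohm1P pS ntS) oOhm; rewrite (negPf ncS) /=.
case/eqP/quaternion_classP=> n n_gt2 isoS.
have [[x y] [_ Sx _ /setDP[Sy X'y]] [oy y2 xy]] := generators_quaternion n_gt2 isoS.
(* [x] has order [2 ^ (n - 1)], so [i] has order 4 and its square is the involution [y * y]. *)
pose i := x ^+ (2 ^ (n - 3)).
have ii: i * i = y * y.
  rewrite -(expgS i 1) -(expgS y 1) y2 -expgM -expnSr; congr (x ^+ (2 ^ _)).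
  by rewrite subnSK ?subn2 //.
(* [y] inverts [x] and hence [i], so the commutator is [(i * i)^-1]; the involution is used below in
   this inverse form. *)
have Vz: [~ i, y] = (y * y)^-1 by rewrite commgEl conjXg xy expgVn -ii invMg.
have y4: (y * y) * (y * y) = 1 by rewrite -[RHS](expg_order y) oy !expgS mulg1 !mulgA.
have y2n1: y * y != 1.
  by rewrite -(expgS y 1) -order_dvdn oy.
apply: (@arranges_to_commutator _ G (y * y)^-1 i y) => //.
- by rewrite groupV groupM ?(subsetP sSG).
- by rewrite groupX ?(subsetP sSG).
- exact: subsetP sSG y Sy.
- by rewrite -invMg y4 invg1.
- by rewrite invg_eq1.
- apply: cent_invol; rewrite ?invg_eq1 // -?invMg ?y4 ?invg1 //.
  by rewrite groupV groupM ?(subsetP sSG).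
- by rewrite ii.
- by rewrite !inE; apply: contra X'y => /pred2P[]->; rewrite ?groupV mem_cycle.
Qed.

(** * Row transversals as column functions *)

Section Tables.

Variables (gT : finGroupType) (G : {group gT}).
Implicit Types (T : {set gT * gT * gT}) (c : gT -> gT).

(** One triple per row amounts to a choice of column [c x] in each row [x]; the entry is then
    forced. *)
Definition column_graph c : {set gT * gT * gT} :=
  [set (x, c x, x * c x) | x in G].

Lemma card_column_graph c (P : pred (gT * gT * gT)) :
  #|[set t in column_graph c | P t]| = #|[set x in G | P (x, c x, x * c x)]|.
Proof.
have inj_graph : injective (fun x => (x, c x, x * c x)) by move=> x y [].
rewrite -(card_imset _ inj_graph); apply: eq_card => t.
rewrite inE; apply/andP/imsetP=> [[/imsetP[x Gx ->] Pt] | [x]].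
  by exists x; rewrite // inE Gx.
by rewrite inE => /andP[Gx Px] ->; split=> //; apply: imset_f.
Qed.

Lemma regular_column_graph c :
    {in G, forall x, c x \in G} ->
    {in G, forall s, #|[set x in G | c x == s]| = #|[set x in G | x * c x == s]|} ->
  regular_row_transversal G (column_graph c).
Proof.
move=> Gc regc; split=> [|x Gx|s Gs]; last by rewrite !card_column_graph regc.
  apply/subsetP=> _ /imsetP[x Gx ->]; apply/imset2P.
  by exists x (c x); rewrite ?Gc.
rewrite card_column_graph -(cards1 x); apply: eq_card => y.
by rewrite !inE /row /=; case: eqP => [->|]; rewrite ?Gx ?andbF.
Qed.

Lemma regular_column_graphP T :
    regular_row_transversal G T ->
  exists c, [/\ T = column_graph c, {in G, forall x, c x \in G}
    & {in G, forall s, #|[set x in G | c x == s]| = #|[set x in G | x * c x == s]|}].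
Proof.
case=> sTG row1 regT.
have memT t : t \in T ->
    [/\ t.1.1 \in G, t.1.2 \in G & t = (t.1.1, t.1.2, t.1.1 * t.1.2)].
  by move/(subsetP sTG)=> /imset2P[x y Gx Gy ->].
(* The default 1 is taken only outside [G], since every row in [G] meets [T]. *)
pose c x := if [pick t in T | row t == x] is Some t then column t else 1.
have Tc x : x \in G -> (x, c x, x * c x) \in T.
  move=> Gx; rewrite /c; case: pickP => [t /andP[Tt /eqP<-] | T0].
    by have [_ _ <-] := memT t Tt.
  by have := row1 x Gx; rewrite eq_card0 // => t; rewrite inE T0.
have defT: T = column_graph c.
  apply/eqP; rewrite eqEsubset andbC; apply/andP; split.
    by apply/subsetP=> _ /imsetP[x Gx ->]; apply: Tc.
  apply/subsetP=> t Tt; have [Gx _ _] := memT t Tt.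
  have /eqP/cards1P[u defu] := row1 _ Gx.
  have: t \in [set u] by rewrite -defu inE Tt /= /row.
  have: (row t, c (row t), row t * c (row t)) \in [set u].
    by rewrite -defu inE Tc //= /row eqxx.
  by rewrite !inE => /eqP<- /eqP->; apply: imset_f.
exists c; split=> // [x Gx | s Gs]; first by have [] := memT _ (Tc x Gx).
by have := regT s Gs; rewrite defT !card_column_graph.
Qed.

(** Replacing [c x] by [c x * g] translates columns and entries alike by [g], so regularity
    persists. The triple in row [x] and column [y] lies in the translate by [(c x)^-1 * y] and in no
    other. *)
Lemma regular_row_transversal_partition T :
    regular_row_transversal G T ->
  exists P : {set {set gT * gT * gT}},
    [/\ partition P (mul_table G), #|P| = #|G|
      & forall U, U \in P -> regular_row_transversal G U].
Proof.
case/regular_column_graphP=> c [_ Gc regc] {T}.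
pose shift g := column_graph (fun x => c x * g).
have shift_row g h t : t \in shift g -> t \in shift h -> g = h.
  case/imsetP=> x _ -> /imsetP[y _ [<- ]].
  by move/mulgI.
have [||tiP injS] := @trivIimset _ _ (mem G) shift.
- move=> g h Gg Gh; apply: contraNT; case/pred0Pn=> t /andP[tg th].
  by rewrite (shift_row _ _ _ tg th).
- apply/imsetP=> -[g Gg /setP/(_ (1, c 1 * g, 1 * (c 1 * g)))].
  by rewrite inE imset_f.
exists (shift @: G); split; last 1 first.
- move=> _ /imsetP[g Gg ->]; apply: regular_column_graph => [x Gx | s Gs].
    by rewrite groupM ?Gc.
  have Gsg: s * g^-1 \in G by rewrite groupM ?groupV.
  have := regc _ Gsg; congr (_ = _); apply: eq_card => x.
    by rewrite !inE -(inj_eq (mulIg g)) mulgKV.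
  by rewrite !inE -(inj_eq (mulIg g)) mulgKV mulgA.
- apply/and3P; split=> //; last first.
    apply/imsetP=> -[g Gg /setP/(_ (1, c 1 * g, 1 * (c 1 * g)))].
    by rewrite inE imset_f.
  apply/eqP/setP=> t; apply/bigcupP/imset2P=> [[_ /imsetP[g Gg ->] /imsetP[x Gx ->]]|].
    by exists x (c x * g); rewrite ?groupM ?Gc.
  case=> x y Gx Gy ->; exists (shift ((c x)^-1 * y)).
    by apply: imset_f; rewrite groupM ?groupV ?Gc.
  by apply/imsetP; exists x; rewrite // mulKVg.
by rewrite card_in_imset.
Qed.

Lemma regular_row_transversal_of_arrangement :
  arranges_to G 1 -> exists T, regular_row_transversal G T.
Proof.
case=> s sG prods; pose c x := \prod_(y <- drop (index x s).+1 s) y.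
have Us: uniq s by rewrite (perm_uniq sG) enum_uniq.
have Gs x : x \in s -> x \in G by rewrite (perm_mem sG) mem_enum.
have card_s (Q : pred gT) :
    #|[set x in G | Q x]| = \sum_(0 <= i < size s) Q (nth 1%g s i).
  rewrite -sum1dep_card big_mkcondr -big_enum /= -(perm_big _ sG) /=.
  by rewrite (big_nth 1); apply: eq_bigr => i _; case: (Q _).
exists (column_graph c); apply: regular_column_graph => [x Gx | a Ga].
  by rewrite /c big_seq group_prod // => y /mem_drop/Gs.
(* [F i] records whether the product of the suffix from position [i] is [a]. Columns count [F 1] up
   to [F (size s)], entries [F 0] up to [F (size s - 1)]; the end terms agree because the full and
   the empty product are both 1. *)
rewrite !card_s; pose F i : nat := (\prod_(y <- drop i s) y)%g == a.
have c_nth i : i < size s -> c (nth 1 s i) = \prod_(y <- drop i.+1 s) y.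
  by move=> lti; rewrite /c index_uniq.
transitivity (\sum_(0 <= i < size s) F i.+1).
  by apply: eq_big_nat => i /andP[_ lti]; rewrite c_nth.
transitivity (\sum_(0 <= i < size s) F i); last first.
  by apply: eq_big_nat => i /andP[_ lti]; rewrite c_nth // /F (drop_nth 1) // big_cons.
apply: (@addnI (F 0)); rewrite -big_nat_recl // big_nat_recr //= addnC.
by rewrite /F drop0 drop_size big_nil prods.
Qed.

End Tables.

(** * The transfer obstruction for cyclic Sylow 2-subgroups *)

Section Transfer.

Import FiniteModule.
Variables (gT : finGroupType) (G : {group gT}).

(** Regularity gives the sums of [f (x * c x)] and of [f (c x)] the same value; additivity then lets
    the latter cancel. *)
Lemma regular_sum0 (V : zmodType) (f : gT -> V) T :
    regular_row_transversal G T ->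
    {in G &, forall x y, f (x * y) = (f x + f y)%R} ->
  (\sum_(x in G) f x = 0)%R.
Proof.
case/regular_column_graphP=> c [_ Gc regc] fM.
have sum_count (d : gT -> gT) : {in G, forall x, d x \in G} ->
    (\sum_(x in G) f (d x) = \sum_(s in G) f s *+ #|[set x in G | d x == s]|)%R.
  move=> Gd; rewrite (partition_big d (mem G)) //=; apply: eq_bigr => s _.
  rewrite -sum1dep_card -GRing.sumrMnr; apply: eq_bigr.
  by move=> x /andP[_ /eqP->].
apply: (@GRing.addIr _ (\sum_(x in G) f (c x))%R).
rewrite GRing.add0r -big_split /= (eq_bigr (fun x => f (x * c x))) => [|x Gx].
  rewrite !sum_count // => [|x Gx]; last by rewrite groupM ?Gc.
  by apply: eq_bigr => s Gs; rewrite regc.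
by rewrite fM ?Gc.
Qed.

Lemma expg_odd (x : gT) k : x * x = 1 -> x ^+ k = x ^+ odd k.
Proof. by move=> xx; rewrite -modn2 expg_mod ?(expgS x 1). Qed.

(** An orbit of length [k] of [x] on the cosets of [S] contributes a conjugate of [x ^+ k] lying in
    [S]. This is [z ^+ k]: it is 1 for even [k], and an involution of [S] for odd [k]. The orbit
    lengths add up to the odd index. *)
Lemma transfer_involution (S : {group gT}) z (sSG : S \subset G)
    (abS : abelian (idm S @* S)) :
    odd #|G : S| -> z \in S -> z * z = 1 ->
    {in S, forall x, x * x = 1 -> x != 1 -> x = z} ->
  {in G, forall x, x * x = 1 -> x != 1 -> transfer G abS x = fmod abS z}.
Proof.
move=> oddGS Sz zz uniqz x Gx xx x1.
have trX := transversalP (rcosets_cycle_partition sSG Gx).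
rewrite (transfer_cycle_expansion sSG abS Gx trX).
have Sz' : z \in idm S @* S by rewrite morphim_idm.
transitivity (fmod abS z *+ #|G : S|)%R; last first.
  by rewrite -fmodX // expg_odd // oddGS.
rewrite -(sum_index_rcosets_cycle sSG Gx trX) -GRing.sumrMnr.
apply: eq_bigr => y Xy; rewrite -fmodX //=; set k := #|_ : _|.
congr (fmod _ _).
have := mulg_exp_card_rcosets S x y; rewrite -/k mem_rcoset -mulgA.
have -> : y * (x ^+ k * y^-1) = x ^+ k ^ y^-1 by rewrite conjgE invgK.
rewrite (expg_odd _ xx) (expg_odd _ zz); case: (odd k) => Sh /=.
  rewrite !expg1 in Sh *; apply: uniqz; rewrite // ?conjg_eq1 //.
  by rewrite -conjMg xx conj1g.
by rewrite !expg0 conj1g.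
Qed.

Lemma regular_row_transversal_Sylow2 T (S : {group gT}) :
  regular_row_transversal G T -> 2.-Sylow(G) S -> S :=: 1 \/ ~~ cyclic S.
Proof.
move=> regT sylS; have [cycS | ] := boolP (cyclic S); [left | by right].
apply/eqP; apply: contraT => ntS; have [sSG pS _] := and3P sylS.
have [_ /Cauchy[]// z Sz oz _] := pgroup_pdiv pS ntS.
have z1: z != 1 by rewrite -order_gt1 oz.
have zz: z * z = 1 by rewrite -(expgS z 1) -oz expg_order.
have uniqz: {in S, forall x, x * x = 1 -> x != 1 -> x = z}.
  move=> x Sx xx x1; have ox: #[x] = 2.
    by apply: nt_prime_order; rewrite ?(expgS x 1).
  (* A cyclic group has at most one subgroup of each order. *)
  have: <[x]> == <[z]>.
    by rewrite (eq_subG_cyclic cycS) ?cycle_subG // -!orderE ox oz.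
  move/eqP=> eqxz; have: x \in <[z]> by rewrite -eqxz cycle_id.
  by rewrite (cycle2g oz) !inE (negPf x1) => /eqP.
have abS: abelian (idm S @* S) by rewrite morphim_idm ?cyclic_abelian.
have oddGS: odd #|G : S|.
  by have [_ _] := and3P sylS; rewrite p'natE // dvdn2 negbK.
have evenG: ~~ odd #|G|.
  rewrite -dvdn2 (dvdn_trans _ (cardSg sSG)) //.
  by rewrite -oz order_dvdG.
have trI := transfer_involution sSG abS oddGS Sz zz uniqz.
have := regular_sum0 regT (fun x y => @transferM _ _ G S _ abS x y).
pose D := [set x in G | x * x == 1]; pose B := [set x in G | x * x != 1].
have BV: {in B, forall x, x^-1 \in B}.
  by move=> x; rewrite !inE groupV -invMg invg_eq1.
have Bne: {in B, forall x, x^-1 != x}.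
  by move=> x /setIdP[_]; rewrite eq_invg_mul.
have [s sB] := fixedfree_involution_half BV (in1W (@invgK _)) Bne.
have cardB: #|B| = (size s).*2.
  by rewrite cardE -(perm_size sB) size_cat size_map addnn.
have sumB: (\sum_(x in B) transfer G abS x = 0)%R.
  rewrite -big_enum -(perm_big _ sB) big_cat big_map /= -big_split big1_seq //= => x sx.
  have: x \in B by rewrite -mem_enum -(perm_mem sB) mem_cat sx.
  by case/setIdP=> Gx _; rewrite -transferM ?groupV // mulgV morph1.
have sumD: (\sum_(x in D) transfer G abS x = fmod abS z *+ #|D :\ 1%g|)%R.
  rewrite (big_setD1 1%g) /=; last by rewrite inE group1 mulg1 eqxx.
  rewrite morph1 GRing.add0r -GRing.sumr_const.
  apply: eq_bigr => x; rewrite !inE => /and3P[x1 Gx /eqP xx].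
  exact: trI.
(* [#|G|] and [#|B|] are even, hence so is [#|D|], and removing 1 leaves an odd number of
   involutions. *)
have oddD: odd #|D :\ 1|.
  have cardD := cardsD1 1 D; rewrite !inE group1 mulg1 eqxx in cardD.
  have: #|G| = #|D| + #|B|.
    rewrite -(cardsID [set x | x * x == 1] G); congr (_ + _).
      by apply: eq_card => x; rewrite !inE.
    by apply: eq_card => x; rewrite !inE andbC.
  move=> cardG; move: evenG.
  by rewrite cardG cardD cardB add1n oddD odd_double addbF /= negbK.
rewrite (bigID (fun x : gT => x * x == 1)) /=.
rewrite (eq_bigl [in D]) => [|x]; last by rewrite inE.
rewrite (eq_bigl [in B] (P1 := fun x => (x \in G) && _)) => [|x]; last by rewrite inE.
have Sz' : z \in idm S @* S by rewrite morphim_idm.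
(* The total is an odd power of [z], that is [z] itself, so its vanishing would force [z = 1]. *)
rewrite sumB sumD GRing.addr0 -fmodX // expg_odd // oddD => /(congr1 fmval).
by rewrite fmodK // => /eqP; rewrite (negPf z1).
Qed.

End Transfer.

(** * Equivalence of the four conditions *)

Lemma mem_full_products (gT : finGroupType) (G : {group gT}) g :
  arranges_to G g -> g \in full_products G.
Proof.
case=> s sG <-; have size_s : size s == #|G| by rewrite (perm_size sG) -cardE.
by apply/imsetP; exists (Tuple size_s); rewrite ?inE.
Qed.

Theorem theorem9 (gT : finGroupType) (G : {group gT}) (n : nat)
    (oG : #|G| = n) :
  [<-> exists T : {set gT * gT * gT}, regular_row_transversal G T;
       exists P : {set {set gT * gT * gT}},
         [/\ partition P (mul_table G), #|P| = n
           & forall T, T \in P -> regular_row_transversal G T];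
       forall S : {group gT}, 2.-Sylow(G) S -> S :=: 1 \/ ~~ cyclic S;
       1 \in full_products G].
Proof.
tfae.
- by case=> T regT; rewrite -oG; apply: regular_row_transversal_partition regT.
- case=> P [_ cardP regP] S sylS.
  have /card_gt0P[T /regP regT] : 0 < #|P| by rewrite cardP -oG.
  exact: regular_row_transversal_Sylow2 regT sylS.
- by move/arranges_to_Sylow2/mem_full_products.
case/imsetP=> s; rewrite inE => sG prods.
by apply: regular_row_transversal_of_arrangement; exists s.
Qed.
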